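(* Let $n\ge 1$, let $1\leq k\leq n$ be an integer, and let $H\in\mathcal{H}_n$. Then the function $$\mathcal{H}_n^{++}\longrightarrow\mathbb{R},\qquad A\longmapsto \left(\mathrm{Tr}_k[\exp(H+\ln A)]\right)^{\frac{1}{k}}$$ is concave on $\mathcal{H}_n^{++}$. Equivalently, for any $1\le k\le n$ and any $H\in\mathcal{H}_n$, the function $$\mathcal{H}_n^{++}\longrightarrow\mathbb{R},\qquad A\longmapsto \ln \mathrm{Tr}_k[\exp(H+\ln A)]$$ is concave on $\mathcal{H}_n^{++}$.
   Context: $\mathcal{H}_n$ is the real linear space of $n\times n$ complex Hermitian matrices and $\mathcal{H}_n^{++}\subset\mathcal{H}_n$ is the convex cone of positive definite ones. For a matrix $A\in\mathbb{C}^{n\times n}$ with eigenvalues $\lambda_1,\dots,\lambda_n$ (with multiplicity), the $k$-trace is the $k$-th elementary symmetric polynomial of the eigenvalues, $\mathrm{Tr}_k[A]=\sum_{1\le i_1<\cdots<i_k\le n}\lambda_{i_1}\cdots\lambda_{i_k}$, $1\le k\le n$ (equivalently, the sum of all $k\times k$ principal minors of $A$). Functions such as $\exp$ and $\ln$ are applied to Hermitian matrices (positive definite for $\ln$) through the spectral decomposition: $f(A)=\sum_i f(\lambda_i)u_iu_i^*$, where $u_i$ are orthonormal eigenvectors with eigenvalues $\lambda_i$. *)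

(* Defs.v *)
From HB Require Import structures.
From mathcomp Require Import all_boot all_order all_algebra spectral.
From mathcomp Require Import complex.
From mathcomp Require Import all_classical all_reals all_analysis.

Set Implicit Arguments.
Unset Strict Implicit.
Unset Printing Implicit Defensive.

Import Order.TTheory GRing.Theory Num.Theory.

Local Open Scope classical_set_scope.
Local Open Scope ring_scope.
Local Open Scope sesquilinear_scope.
Local Open Scope complex_scope.

Section Defs.
Context {R : realType}.
Local Notation C := R[i].

(* In the order of [C], [0 < z] means that [z] is real and positive. *)
Definition posdefmx n : set 'M[C]_n :=
  [set A | A \is hermsymmx /\
           forall v : 'cV[C]_n, v != 0 -> 0 < (v ^t* *m A *m v) 0 0].

(* The [i]-th row of [spectralmx A] is the conjugate transpose of the
   [i]-th eigenvector [u_i], so this is [\sum_i f(lambda_i) u_i u_i^*].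
   The value is meaningful for Hermitian [A], whose eigenvalues are real; it
   does not depend on the eigenbasis, see [spectral_funE]. *)
Definition spectral_fun n (f : R -> R) (A : 'M[C]_n) : 'M[C]_n :=
  (spectralmx A) ^t*
    *m diag_mx (map_mx (fun z => (f (complex.Re z))%:C) (spectral_diag A))
    *m spectralmx A.

Definition expmx n (A : 'M[C]_n) : 'M[C]_n := spectral_fun expR A.
Definition lnmx n (A : 'M[C]_n) : 'M[C]_n := spectral_fun (@ln R) A.

(* The list of the [n] roots, with multiplicity, of the characteristic
   polynomial. *)
Definition eigenvalues n (A : 'M[C]_n) : seq C :=
  sval (closed_field_poly_normal (char_poly A)).

Definition ktrace n (k : nat) (A : 'M[C]_n) : C :=
  \sum_(I : {set 'I_n} | #|I| == k) \prod_(i in I) (eigenvalues A)`_i.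

(* Taking the real part loses nothing, see [ktrace_exp_add_ln_gt0]. *)
Definition ktrace_exp_add_ln n (k : nat) (H A : 'M[C]_n) : R :=
  complex.Re (ktrace k (expmx (H + lnmx A))).

Definition concave_on n (D : set 'M[C]_n) (f : 'M[C]_n -> R) : Prop :=
  forall (A B : 'M[C]_n) (t : R), D A -> D B -> 0 <= t <= 1 ->
    t * f A + (1 - t) * f B <= f (t%:C *: A + (1 - t)%:C *: B).

Lemma posdefmx_convex n (A B : 'M[C]_n) (t : R) :
  posdefmx A -> posdefmx B -> 0 <= t <= 1 ->
  posdefmx (t%:C *: A + (1 - t)%:C *: B).
Proof.
move=> [hA pA] [hB pB] /andP[t0 t1]; split.
  move: hA hB => /is_hermitianmxP hA /is_hermitianmxP hB.
  apply/is_hermitianmxP; move: hA hB; rewrite !expr0 !scale1r => hA hB.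
  apply/matrixP => i j; move/matrixP: hA => /(_ i j); move/matrixP: hB => /(_ i j).
  rewrite !mxE => -> ->; set s := 1 - t.
  rewrite [RHS](rmorphD Num.conj) 2!(rmorphM Num.conj).
  have cR (x : R) : Num.conj (x%:C : C) = x%:C by exact: conjc_real.
  by congr (_ * _ + _ * _); exact/esym/cR.
move=> v v0; rewrite mulmxDr mulmxDl -!scalemxAr -!scalemxAl mxE.
rewrite [X in X + _]mxE [X in _ + X]mxE.
move: t0; rewrite le_eqVlt => /predU1P[<-|t0].
  by rewrite mul0r add0r subr0 mul1r pB.
apply: ltr_wpDr; first by apply: mulr_ge0; rewrite ?ler0c ?subr_ge0 // ltW // pB.
by rewrite mulr_gt0 ?pA// ltcR.
Qed.

Lemma spectral_funE n (f : R -> R) (U : 'M[C]_n) (d : 'rV[R]_n) :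
  U \is unitarymx ->
  spectral_fun f (U ^t* *m diag_mx (map_mx (real_complex R) d) *m U) =
  U ^t* *m diag_mx (map_mx (fun x => (f x)%:C) d) *m U.
Proof.
move=> Uu; set A := (X in spectral_fun f X).
have Unorm : A \is normalmx.
  by apply/orthomx_spectral_subproof; exists (U, map_mx (real_complex R) d);
     rewrite //= invmx_unitary.
have Vu := spectral_unitarymx A.
have /orthomx_spectralP := Unorm; rewrite invmx_unitary //.
rewrite /spectral_fun; move: Vu.
set V := spectralmx A; set e := spectral_diag A => Vu AE.
have UU := unitarymxP Uu; have VV := unitarymxP Vu.
have UU' : U ^t* *m U = 1%:M by apply: mulmx1C.
have VV' : V ^t* *m V = 1%:M by apply: mulmx1C.
pose W := V *m U ^t*.
have WE : W *m diag_mx (map_mx (real_complex R) d) = diag_mx e *m W.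
  have : V *m A *m U ^t* = V *m (V ^t* *m diag_mx e *m V) *m U ^t* by rewrite -AE.
  rewrite /A !mulmxA VV mul1mx -!mulmxA UU mulmx1 => ->.
  by [].
have WfE : W *m diag_mx (map_mx (fun x => (f x)%:C) d) =
           diag_mx (map_mx (fun z => (f (complex.Re z))%:C) e) *m W.
  apply/matrixP => i j; move/matrixP: WE => /(_ i j).
  move: W => W.
  rewrite !mul_mx_diag !mul_diag_mx !mxE.
  have [->|w0] := eqVneq (W i j) 0; first by rewrite !(mulr0, mul0r).
  by rewrite [e 0 i * _]mulrC => h; have <- := mulfI w0 h; rewrite mulrC.
have -> : V = W *m U by rewrite /W -mulmxA UU' mulmx1.
have -> : (W *m U) ^t* = U ^t* *m W ^t* by rewrite trmx_mul map_mxM.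
rewrite -!mulmxA; congr (_ *m _); rewrite !mulmxA; congr (_ *m _).
rewrite -mulmxA -[V *m U ^t*]/W -mulmxA -WfE mulmxA.
have -> : W ^t* *m W = 1%:M; last by rewrite mul1mx.
by rewrite /W trmx_mul map_mxM trmxCK !mulmxA -[U *m _ *m V]mulmxA VV' mulmx1.
Qed.

Lemma spectral_fun_herm n (f : R -> R) (A : 'M[C]_n) :
  spectral_fun f A \is hermsymmx.
Proof.
apply/is_hermitianmxP; rewrite expr0 scale1r /spectral_fun.
rewrite !trmx_mul !map_mxM trmxCK -mulmxA; congr (_ *m (_ *m _)).
apply/matrixP => i j; rewrite !mxE eq_sym; case: eqP => [->|_].
  by rewrite !mulr1n; exact/esym/conjc_real.
by rewrite !mulr0n rmorph0.
Qed.

Lemma size_eigenvalues n (A : 'M[C]_n) : size (eigenvalues A) = n.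
Proof.
rewrite /eigenvalues; case: closed_field_poly_normal => r /= rE.
have := size_char_poly A; rewrite rE (monicP (char_poly_monic A)) scale1r.
by rewrite size_prod_XsubC => -[].
Qed.

Lemma mem_eigenvalues n (A : 'M[C]_n) z :
  (z \in eigenvalues A) = eigenvalue A z.
Proof.
rewrite eigenvalue_root_char /eigenvalues.
case: closed_field_poly_normal => r /= rE.
by rewrite rE (monicP (char_poly_monic A)) scale1r root_prod_XsubC.
Qed.

Lemma ktrace_expmx_gt0 n k (A : 'M[C]_n) :
  (k <= n)%N -> 0 < ktrace k (expmx A).
Proof.
move=> kn.
have ev_gt0 (i : 'I_n) : 0 < (eigenvalues (expmx A))`_i.
  have : (eigenvalues (expmx A))`_i \in eigenvalues (expmx A).
    by rewrite mem_nth ?size_eigenvalues.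
  rewrite mem_eigenvalues => /eigenvalueP[v vE v0].
  move: (nth _ _ _) vE => z; rewrite /expmx /spectral_fun.
  have /unitarymxP := spectral_unitarymx A.
  set P := spectralmx A; set D := diag_mx _ => PP vE.
  have wE : v *m P ^t* *m D = z *: (v *m P ^t*).
    move/(congr1 (mulmx^~ (P ^t*))): vE; rewrite !mulmxA -[_ *m P *m _]mulmxA.
    by rewrite PP mulmx1 -scalemxAl.
  have [j wj] : exists j, (v *m P ^t*) 0 j != 0.
    apply/existsP; apply: contraNT v0; rewrite negb_exists => /forallP w0.
    have w0' : v *m P ^t* = 0.
      by apply/rowP => j; rewrite [RHS]mxE; apply/eqP; rewrite -[_ == _]negbK w0.
    by rewrite -[v]mulmx1 -(mulmx1C PP) mulmxA w0' mul0mx.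
  move: (v *m P ^t*) wE wj => w /rowP/(_ j); rewrite mul_mx_diag !mxE mulrC.
  by move=> h wj; rewrite -(mulIf wj h) ltcR expR_gt0.
have prod_gt0 (I : {set 'I_n}) :
    0 < \prod_(i in I) (eigenvalues (expmx A))`_i by apply: prodr_gt0.
have [I0 I0k] : exists I0 : {set 'I_n}, #|I0| == k.
  have : (0 < #|[set I : {set 'I_n} | #|I| == k]%SET|)%N.
    by rewrite card_draws card_ord bin_gt0.
  by rewrite card_gt0 => /set0Pn[I0]; rewrite inE; exists I0.
rewrite /ktrace (bigD1 I0) //=; apply: ltr_wpDr => //.
by apply: sumr_ge0 => I _; exact: ltW.
Qed.

Lemma ktrace_exp_add_ln_gt0 n k (H A : 'M[C]_n) : (k <= n)%N ->
  0 < ktrace_exp_add_ln k H A /\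
  (ktrace_exp_add_ln k H A)%:C = ktrace k (expmx (H + lnmx A)).
Proof.
move=> kn; have := ktrace_expmx_gt0 (H + lnmx A) kn.
rewrite /ktrace_exp_add_ln; case: (ktrace _ _) => a b.
by rewrite ltcE /= => /andP[/eqP -> ->].
Qed.

End Defs.

(* Main.v *)
Require Import Defs.
From mathcomp Require Import all_boot all_order fingroup perm all_algebra spectral.
From mathcomp Require Import complex.
From mathcomp Require Import all_classical all_reals all_analysis.
From mathcomp Require Import ring lra.

Set Implicit Arguments.
Unset Strict Implicit.
Unset Printing Implicit Defensive.

Import Order.TTheory GRing.Theory Num.Theory.

Local Open Scope ring_scope.

(** The function [Tr_k (exp (H + ln A)) ^ (1/k)] is an infimum, over Hermitian
    [Z] in a suitable class, of the functions [Tr (exp (H + Z + ln A))], each of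
    which is concave in [A] by Lieb's theorem.

    The class is given by duality. Let [e_k] be the elementary symmetric
    polynomial; [e_k ^ (1/k)] is concave on the positive orthant (Marcus-Lopes
    and Garding), so it is the infimum of the linear forms [a |-> <a, y>] that
    dominate it. If [y] is such a form and [Z] is Hermitian with spectrum [ln y],
    then [Tr_k (exp L) ^ (1/k) <= Tr (exp (L + Z))] for every Hermitian [L]:
    Peierls' inequality bounds the right-hand side below by
    [\sum_i exp (l_i + \sum_j P_ij ln y_j)] with [P] bistochastic, and
    rearrangement reduces [P] to a permutation. Equality holds when [Z] is
    diagonal in the eigenbasis of [L] and [y] is the gradient at the spectrum of
    [exp L].

    Lieb's theorem follows from Gibbs' variational principle and the joint
    concavity of [Tr (X ln A - X ln X)]. The latter is approximated by positive
    combinations of the sums of [x (a - x) / (p x + q a)] over the spectra,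
    which are jointly concave because [Tr K^* X] is linear and
    [x ^ 2 / (p x + q a)] is a supremum over [K] of forms linear in [X] and [A]. *)


(** * Elementary symmetric polynomials *)

Section ElementarySymmetric.
Variables (F : realFieldType) (I : finType).
Implicit Types (S : {set I}) (k : nat) (a b : I -> F).

Definition esym S k a : F :=
  \sum_(J : {set I} | (J \subset S) && (#|J| == k)) \prod_(i in J) a i.

Lemma esym0 S a : esym S 0 a = 1.
Proof.
rewrite /esym (bigD1 finset.set0) /= ?finset.sub0set ?cards0 //.
rewrite big_set0 big1 ?addr0// => J /andP[/andP[_ /eqP/cards0_eq ->]].
by rewrite eqxx.
Qed.

Lemma esym_ge0 S k a : (forall i, 0 < a i) -> 0 <= esym S k a.
Proof. by move=> a0; apply: sumr_ge0 => J _; apply: prodr_ge0 => i _; exact: ltW. Qed.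

Lemma esym_gt0 S k a : (forall i, 0 < a i) -> (k <= #|S|)%N -> 0 < esym S k a.
Proof.
move=> a0 kS.
have : (0 < #|[set J : {set I} | J \subset S & #|J| == k]|)%N.
  by rewrite cards_draws bin_gt0.
rewrite card_gt0 => /set0Pn[J]; rewrite inE => SJ.
rewrite /esym (bigD1 J) //=; apply: ltr_wpDr; last exact: prodr_gt0.
by apply: sumr_ge0 => T _; apply: prodr_ge0 => i _; exact: ltW.
Qed.

Lemma esymD1 S i k a : i \in S ->
  esym S k.+1 a = a i * esym (S :\ i) k a + esym (S :\ i) k.+1 a.
Proof.
move=> iS; rewrite /esym (bigID (fun J : {set I} => i \in J)) /=; congr (_ + _).
  rewrite mulr_sumr (reindex_onto (fun J => i |: J) (fun J => J :\ i)) /=; last first.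
    by move=> J /andP[_ iJ]; rewrite finset.setD1K.
  apply: eq_big => [J|J].
    rewrite finset.setU11 andbT finset.subUset finset.sub1set iS /= finset.subsetD1 cardsU1.
    case: (boolP (i \in J)) => iJ.
      rewrite andbF/=; apply/negP => /andP[_ /eqP E].
      by move: iJ; rewrite -E finset.setD11.
    by rewrite finset.setU1K // eqxx !andbT.
  move=> /andP[_ /eqP E]; rewrite big_setU1 //=.
  by rewrite -E finset.setD11.
by apply: eq_bigl => J; rewrite finset.subsetD1 -!andbA; congr (_ && _); rewrite andbC.
Qed.

(** Double counting of the pairs [i \in J]: the products in [esym S k.+1] that contain [a i] sum to
    [a i * esym (S :\ i) k a]. Unit weights give Euler's identity, general ones [desym_weighted]. *)
Lemma esym_euler_weighted S k a (d : I -> F) :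
  \sum_(i in S) d i * (a i * esym (S :\ i) k a) =
  \sum_(J : {set I} | (J \subset S) && (#|J| == k.+1))
    (\sum_(i in J) d i) * \prod_(i in J) a i.
Proof.
transitivity (\sum_(i in S) \sum_(J : {set I} | (J \subset S) && (#|J| == k.+1)
   && (i \in J)) d i * \prod_(j in J) a j).
  apply: eq_bigr => i iS; rewrite -mulr_sumr; congr (_ * _).
  have := esymD1 k a iS; rewrite /esym (bigID (fun J : {set I} => i \in J)) /=.
  have -> : \sum_(J : {set I} | (J \subset S) && (#|J| == k.+1) && (i \notin J))
    \prod_(j in J) a j = esym (S :\ i) k.+1 a.
    by apply: eq_bigl => J; rewrite finset.subsetD1 -!andbA; congr (_ && _); rewrite andbC.
  by move=> /addIr ->.
rewrite (exchange_big_dep (fun J : {set I} => (J \subset S) && (#|J| == k.+1))) /=; last first.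
  by move=> i J _ /andP[].
apply: eq_bigr => J /andP[JS /eqP Jk]; rewrite mulr_suml.
apply: eq_bigl => i; rewrite JS Jk eqxx /= andbC.
by case: (boolP (i \in J)) => //= /(fintype.subsetP JS).
Qed.

Lemma esym_euler S k a :
  \sum_(i in S) a i * esym (S :\ i) k a = k.+1%:R * esym S k.+1 a.
Proof.
have := esym_euler_weighted S k a (fun=> 1).
under eq_bigr do rewrite mul1r.
move=> ->; rewrite mulr_sumr; apply: eq_bigr => J /andP[_ /eqP Jk].
by rewrite sumr_const Jk.
Qed.

(* The derivative of [esym S k] at [b] in the direction [a]. *)
Definition desym S k a b : F :=
  if k is k'.+1 then \sum_(i in S) a i * esym (S :\ i) k' b else 0.

Lemma desymD1 S i k a b : i \in S -> desym S k.+1 a b =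
  a i * esym (S :\ i) k b + b i * desym (S :\ i) k a b + desym (S :\ i) k.+1 a b.
Proof.
move=> iS; rewrite /= (big_setD1 i) //= -addrA; congr (_ + _).
case: k => [|k] /=.
  by rewrite mulr0 add0r; apply: eq_bigr => j _; rewrite !esym0.
rewrite mulr_sumr -big_split /=; apply: eq_bigr => j; rewrite !inE => /andP[ji jS].
rewrite (@esymD1 _ i); last by rewrite !inE eq_sym ji.
by rewrite (finset.setDDl S) finset.setUC -finset.setDDl; ring.
Qed.

(** Euler's identity at [b], differentiated in the direction [a], just as [desymD1] is the
    derivative of [esymD1]. *)
Lemma desym_euler S k a b :
  \sum_(i in S) (a i * esym (S :\ i) k b + b i * desym (S :\ i) k a b) =
  k.+1%:R * desym S k.+1 a b.
Proof.
rewrite big_split /= -natr1 mulrDl mul1r addrC; congr (_ + _).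
case: k => [|k] /=.
  by rewrite mul0r big1 // => i _; rewrite mulr0.
rewrite mulr_sumr; under eq_bigr do rewrite mulr_sumr.
rewrite (exchange_big_dep (fun j => j \in S)) /=; last by move=> i j _; rewrite inE => /andP[].
apply: eq_bigr => j jS; rewrite mulrCA -esym_euler mulr_sumr.
apply: eq_big => [i|i]; first by rewrite !inE jS andbT eq_sym andbC.
by rewrite (finset.setDDl S) finset.setUC -finset.setDDl mulrCA.
Qed.

Lemma esym_euler2 S k a :
  k.+2%:R * esym S k.+2 a =
  (\sum_(i in S) a i) * esym S k.+1 a - \sum_(i in S) a i ^+ 2 * esym (S :\ i) k a.
Proof.
rewrite -esym_euler mulr_suml -sumrB; apply: eq_bigr => i iS.
by rewrite (esymD1 k a iS); ring.
Qed.

(** A recursion on the degree: with [q] the quotient for [S :\ i] one degree lower, each summand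
    equals [a i * q / (a i + q)]. This parallel sum is jointly concave and nondecreasing in [q], so
    concavity is inherited. *)
Lemma esym_quot S k a : (forall i, 0 < a i) -> (k < #|S|)%N ->
  k.+2%:R * (esym S k.+2 a / esym S k.+1 a) =
  \sum_(i in S)
    (a i - a i ^+ 2 / (a i + esym (S :\ i) k.+1 a / esym (S :\ i) k a)).
Proof.
move=> a0 kS; have e0 : esym S k.+1 a != 0 by rewrite gt_eqF// esym_gt0.
rewrite mulrA esym_euler2 mulrBl mulfK // sumrB; congr (_ - _).
rewrite mulr_suml; apply: eq_bigr => i iS; rewrite -mulrA; congr (_ * _).
have f0 : 0 < esym (S :\ i) k a.
  by rewrite esym_gt0 //; move: kS; rewrite (cardsD1 i S) iS.
have f1 := esym_ge0 (S :\ i) k.+1 a0; have ai := a0 i.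
move: e0; rewrite (esymD1 k a iS) => e0.
have g0 : a i + esym (S :\ i) k.+1 a / esym (S :\ i) k a != 0.
  by rewrite gt_eqF // ltr_wpDr // divr_ge0 // ltW.
by field; rewrite e0 gt_eqF.
Qed.

(* Marcus and Lopes: [esym S k.+1 / esym S k] is concave, here in the form of
   its gradient inequality at [b]. *)
Lemma esym_quot_gradient S k a b :
  (forall i, 0 < a i) -> (forall i, 0 < b i) -> (k <= #|S|)%N ->
  esym S k.+1 a / esym S k a * esym S k b ^+ 2 <=
  desym S k.+1 a b * esym S k b - esym S k.+1 b * desym S k a b.
Proof.
move=> a0 b0; elim: k S => [|k IH] S kS.
  rewrite !esym0 /= expr1n !mulr1 mulr0 subr0 divr1.
  have := esym_euler S 0 a; rewrite mul1r => <-.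
  by apply: ler_sum => i _; rewrite !esym0.
rewrite -(ler_pM2l (ltr0Sn F k.+1)) mulrA (esym_quot a0 kS) mulrBr !mulrA.
rewrite -desym_euler -esym_euler !mulr_suml -sumrB; apply: ler_sum => i iS.
have kSi : (k <= #|S :\ i|)%N by move: kS; rewrite (cardsD1 i S) iS.
move: (IH _ kSi) (esym_gt0 a0 kSi) (esym_ge0 (S :\ i) k.+1 a0) (a0 i).
rewrite (esymD1 _ _ iS) (desymD1 _ _ _ iS).
set q := _ / _ => IHi A1 A2 ai; have q0 : 0 <= q by rewrite divr_ge0 // ltW.
have aq : 0 < a i + q by rewrite ltr_wpDr.
set e1 := esym _ k b in IHi *; set e2 := esym _ k.+1 b in IHi *.
set d1 := desym _ k a b in IHi *; set d2 := desym _ k.+1 a b in IHi *.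
have -> : (a i * e2 + b i * d2) * (b i * e1 + e2)
          - b i * e2 * (a i * e1 + b i * d1 + d2)
        = a i * e2 ^+ 2 + b i ^+ 2 * (d2 * e1 - e2 * d1) by ring.
have IHb : b i ^+ 2 * (q * e1 ^+ 2) <= b i ^+ 2 * (d2 * e1 - e2 * d1).
  by rewrite ler_wpM2l ?sqr_ge0.
apply: le_trans (lerD (lexx _) IHb).
have -> : a i - a i ^+ 2 / (a i + q) = a i * q / (a i + q).
  by field; rewrite gt_eqF.
rewrite -mulrA mulrAC ler_pdivrMr // -subr_ge0.
(* The tangent-plane inequality for the parallel sum at [(b i, e2 / e1)], cleared of denominators:
   its defect is a square. *)
rewrite (_ : _ - _ = (q * (b i * e1) - a i * e2) ^+ 2) ?sqr_ge0 //; ring.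
Qed.

(* Summing the gradient inequality over the factors of
   [esym S k = \prod_(r < k) esym S r.+1 / esym S r] and applying AM-GM gives
   Garding's inequality for [esym S k]. *)
Lemma esym_garding S k a b :
  (forall i, 0 < a i) -> (forall i, 0 < b i) -> (0 < k <= #|S|)%N ->
  esym S k a * (k%:R * esym S k b) ^+ k <= desym S k a b ^+ k * esym S k b.
Proof.
move=> a0 b0 /andP[k0 kS].
pose x (r : nat) := esym S r.+1 a / esym S r a / (esym S r.+1 b / esym S r b).
have xsum r : (r <= #|S|)%N -> \sum_(j < r) x j <= desym S r a b / esym S r b.
  elim: r => [|r IH] rS; first by rewrite big_ord0 mul0r.
  rewrite big_ord_recr /=; apply: le_trans (lerD (IH (ltnW rS)) (lexx _)) _.
  have := esym_quot_gradient a0 b0 (ltnW rS).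
  have := esym_gt0 b0 rS; have := esym_gt0 b0 (ltnW rS).
  rewrite /x; set e := esym S r b; set e' := esym S r.+1 b.
  set q := _ / esym S r a; set d := desym _ r a b; set d' := desym _ r.+1 a b.
  move=> e0 e0' h; rewrite -subr_ge0.
  have -> : d' / e' - (d / e + q / (e' / e)) = (d' * e - e' * d - q * e ^+ 2) / (e * e').
    by field; rewrite !gt_eqF.
  by rewrite divr_ge0 ?subr_ge0 // ltW // mulr_gt0.
have xprod r : (r <= #|S|)%N -> \prod_(j < r) x j = esym S r a / esym S r b.
  elim: r => [|r IH] rS; first by rewrite big_ord0 !esym0 divr1.
  rewrite big_ord_recr /= IH ?(ltnW rS) // /x.
  have := esym_gt0 b0 rS; have := esym_gt0 b0 (ltnW rS); have := esym_gt0 a0 (ltnW rS).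
  by move=> h1 h2 h3; field; rewrite !gt_eqF.
have x0 j : (j < k)%N -> 0 <= x j.
  by move=> jk; rewrite !divr_ge0 // ?esym_ge0.
have := leif_AGM (fun (i : 'I_k) (_ : i \in 'I_k) => x0 i (ltn_ord i)).
rewrite card_ord /= => -[+ _].
rewrite (xprod _ kS) => agm.
have ek := esym_gt0 b0 kS; have kk : 0 < k%:R :> F by rewrite ltr0n.
have D0 : 0 <= desym S k a b.
  case: (k) => //= k'; apply: sumr_ge0 => i _; rewrite mulr_ge0 ?esym_ge0//.
  exact: ltW.
have kek : 0 < k%:R * esym S k b by rewrite mulr_gt0.
have : esym S k a / esym S k b <= (desym S k a b / (k%:R * esym S k b)) ^+ k.
  apply: le_trans agm _; rewrite ler_pXn2r ?nnegrE //; last 2 first.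
  - by rewrite divr_ge0 // sumr_ge0 // => i _; exact: x0.
  - by rewrite divr_ge0 // ltW.
  rewrite ler_pdivrMr //; apply: le_trans (xsum _ kS) _.
  rewrite le_eqVlt; apply/orP; left; apply/eqP.
  by field; rewrite !gt_eqF.
rewrite expr_div_n ler_pdivlMr ?exprn_gt0 // => /(ler_wpM2r (ltW ek)).
by rewrite mulrAC divfK ?gt_eqF.
Qed.

Lemma esym_perm (s : {perm I}) k a :
  esym [set: I] k (a \o s) = esym [set: I] k a.
Proof.
symmetry; rewrite /esym (reindex_inj (imset_inj (@perm_inj _ s))) /=.
apply: eq_big => [J|J _]; first by rewrite !finset.subsetT card_imset //; exact: perm_inj.
by rewrite big_imset //; move=> i j _ _; exact: perm_inj.
Qed.

End ElementarySymmetric.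

(** * Rearrangement against bistochastic matrices *)

Section Rearrangement.
Variables (F : realFieldType) (n : nat).
Implicit Types (u v : 'I_n -> F) (P : 'I_n -> 'I_n -> F).

(** A permutation maximising [\sum_i i * u (s i)] sorts [u], since exchanging the values of an
    inverted pair would increase the sum. *)
Lemma sorting_perm u :
  exists s : 'S_n, forall i j : 'I_n, (i <= j)%N -> u (s i) <= u (s j).
Proof.
pose w (s : 'S_n) : F := \sum_(i < n) (i : nat)%:R * u (s i).
have [s _ smax] := @Order.TotalTheory.arg_maxP _ _ _ (1%g : 'S_n) xpredT w isT.
exists s => i j; rewrite leq_eqVlt => /predU1P[/val_inj -> //|ij].
have nij : j != i by rewrite -(inj_eq val_inj) /= gtn_eqF.
have : w (tperm i j * s)%g <= w s by exact: smax.
rewrite /w.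
rewrite (bigD1 i) //= (bigD1 j) //= [in leRHS](bigD1 i) //= [in leRHS](bigD1 j) //=.
rewrite !permM tpermL tpermR.
rewrite (eq_bigr (fun l : 'I_n => (l : nat)%:R * u (s l))); last first.
  by move=> l /andP[li lj]; rewrite permM tpermD // eq_sym.
rewrite !addrA lerD2r => h.
rewrite -subr_ge0 -(pmulr_rge0 _ (_ : 0 < (j : nat)%:R - (i : nat)%:R)) ?subr_gt0 ?ltr_nat //.
rewrite -subr_ge0 in h.
by apply: le_trans h _; rewrite le_eqVlt; apply/orP; left; apply/eqP; ring.
Qed.

(** Weak duality for optimal transport: a dual pair lies below the cost [u i * v j] and is tight on
    the diagonal, and its average against [P] depends only on the marginals. *)
Lemma rearrangement_sorted P u v :
  (forall i j, 0 <= P i j) ->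
  (forall i, \sum_j P i j = 1) -> (forall j, \sum_i P i j = 1) ->
  (forall i j : 'I_n, (i <= j)%N -> u i <= u j) ->
  (forall i j : 'I_n, (i <= j)%N -> v j <= v i) ->
  \sum_i u i * v i <= \sum_i \sum_j P i j * (u i * v j).
Proof.
case: n u v P => [|m] u v P P0 Pr Pc uS vS; first by rewrite !big_ord0.
pose U (l : nat) := u (inord l); pose V (l : nat) := v (inord l).
(* Dual potential of the transport problem: the discrete [int u dv]. *)
pose g (j : nat) := \sum_(l < j) U l * (V l.+1 - V l).
(* Dual feasibility: the increments of [g l - u i * V l] are nonnegative for [l < i] and nonpositive
   from [i] on, so its maximum is at [l = i]. *)
have gmax (i j : 'I_m.+1) : u i * v i - g i + g j <= u i * v j.
  have step (l : nat) : (l < m)%N ->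
      (g l.+1 - u i * V l.+1) - (g l - u i * V l) = (U l - u i) * (V l.+1 - V l).
    by rewrite /g big_ord_recr /=; set x := \sum_(_ < _) _; move=> _; ring.
  have dV (l : nat) : (l < m)%N -> V l.+1 - V l <= 0.
    by move=> lm; rewrite subr_le0 vS // !inordK // ltnS // ltnW.
  suff : g j - u i * V j <= g i - u i * V i.
    by rewrite /V !inord_val => h; lra.
  have up l : (l <= i)%N -> g l - u i * V l <= g i - u i * V i.
    move=> li; rewrite -(subKn li); move: (i - l)%N => d.
    elim: d => [|d IH]; first by rewrite subn0.
    apply: le_trans _ IH; case: (ltnP d i) => [di|di]; last first.
      (* Subtraction is truncated: once [d] reaches [i], both indices are 0. *)
      have E1 : (i - d.+1)%N = 0%N by apply/eqP; exact: leqW.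
      have E2 : (i - d)%N = 0%N by exact/eqP.
      by rewrite E1 E2.
    have lm : (i - d.+1 < m)%N.
      by rewrite -ltnS; apply: leq_trans (ltn_ord i); rewrite ltnS ltn_subrL /= (leq_ltn_trans _ di).
    rewrite -[(i - d)%N]subSS subSn // -subr_ge0 step //.
    rewrite mulr_le0 ?dV // subr_le0 uS // inordK; last exact: ltnW.
    exact: leq_subr.
  have down d : (i + d <= m)%N -> g (i + d)%N - u i * V (i + d)%N <= g i - u i * V i.
    elim: d => [|d IH] dm; first by rewrite addn0.
    rewrite addnS in dm *; apply: le_trans (IH (ltnW dm)); rewrite -subr_le0 step //.
    rewrite mulr_ge0_le0 ?dV // subr_ge0 -[i in u i]inord_val uS //.
    by rewrite inord_val inordK ?leq_addr // ltnW.
  case: (leqP j i) => [|ij]; first exact: up.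
  by rewrite -(subnKC (ltnW ij)); apply: down; rewrite subnKC -1?ltnS // ltnW.
apply: (@le_trans _ _ (\sum_i \sum_j P i j * (u i * v i - g i + g j))).
  rewrite [leRHS](_ : _ = \sum_(i < m.+1) (u i * v i - g i) + \sum_(i < m.+1) g i); last first.
    have -> : \sum_(i < m.+1) g i = \sum_(j < m.+1) \sum_(i < m.+1) P i j * g j.
      by apply: eq_bigr => j _; rewrite -mulr_suml Pc mul1r.
    rewrite [X in _ = _ + X]exchange_big -big_split /=; apply: eq_bigr => i _.
    rewrite -[X in _ = X + _]mul1r -(Pr i) mulr_suml -big_split /=.
by apply: eq_bigr => j _; rewrite mulrDr.
  by rewrite sumrB subrK.
by apply: ler_sum => i _; apply: ler_sum => j _; exact: ler_wpM2l.
Qed.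

(* A substitute for Birkhoff's theorem. *)
Lemma rearrangement P u v :
  (forall i j, 0 <= P i j) ->
  (forall i, \sum_j P i j = 1) -> (forall j, \sum_i P i j = 1) ->
  exists s : 'S_n, \sum_i u i * v (s i) <= \sum_i \sum_j P i j * (u i * v j).
Proof.
move=> P0 Pr Pc.
have [s us] := sorting_perm u; have [t vt] := sorting_perm (fun i => - v i).
(* [s] sorts [u] upwards and [t] sorts [v] downwards, so this pairs the smallest [u] with the
   largest [v]. *)
exists (s^-1 * t)%g.
rewrite (reindex_inj (@perm_inj _ s)) [leRHS](reindex_inj (@perm_inj _ s)) /=.
under eq_bigr do rewrite permM permK.
under [leRHS]eq_bigr do rewrite (reindex_inj (@perm_inj _ t)).
apply: (@rearrangement_sorted (fun i j => P (s i) (t j)) (u \o s) (v \o t)) => //=.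
- by move=> i; rewrite -(Pr (s i)) [RHS](reindex_inj (@perm_inj _ t)).
- by move=> j; rewrite -(Pc (t j)) [RHS](reindex_inj (@perm_inj _ s)).
- by move=> i j ij; rewrite -lerN2; exact: vt.
Qed.

End Rearrangement.

(** * Linear forms dominating the root of an elementary symmetric polynomial *)

Section KTraceScalar.
Variables (R : realType) (n : nat).
Local Notation e := (esym [set: 'I_n]).

Lemma desym_weighted (I : finType) (S : {set I}) k (a d : I -> R) :
  desym S k (fun i => d i * a i) a =
  \sum_(J : {set I} | (J \subset S) && (#|J| == k))
    (\sum_(i in J) d i) * \prod_(i in J) a i.
Proof.
case: k => [|k] /=; last first.
  by rewrite -esym_euler_weighted; apply: eq_bigr => i _; rewrite mulrA.
rewrite big1 // => J /andP[_ /eqP/cards0_eq ->].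
by rewrite [X in X * _]big_set0 mul0r.
Qed.

(* Jensen's inequality for [expR] under the probability on subsets [J] with
   weights [\prod_(i in J) expR (l i)]. *)
Lemma esym_expR_ge (I : finType) (S : {set I}) k (l d : I -> R) :
  (k <= #|S|)%N ->
  0 <= desym S k (fun i => d i * expR (l i)) (fun i => expR (l i)) ->
  esym S k (fun i => expR (l i)) <= esym S k (fun i => expR (l i + d i)).
Proof.
move=> kS; rewrite desym_weighted => d0.
rewrite -[leLHS]addr0; apply: le_trans (lerD (lexx _) d0) _.
rewrite /esym -big_split /=; apply: ler_sum => J _.
under [leRHS]eq_bigr do rewrite expRD.
rewrite big_split /= -[X in _ <= _ * X]expR_sum -[X in X + _]mul1r -mulrDl mulrC.
by rewrite ler_wpM2l ?expR_ge1Dx // prodr_ge0 // => i _; exact: expR_ge0.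
Qed.

(** Scalar core of the domination by [Tr (exp (L + Z))]; [P] will be the overlaps of two eigenbases.
    Moving [l i] by [\sum_j P i j * ln (y j) - ln (y (s i))] does not lower [e k] if [s] comes from
    rearrangement, and the hypothesis on [y] then applies along [s]. *)
Lemma esym_le_linear_expR k (y : 'I_n -> R) (P : 'I_n -> 'I_n -> R)
    (l : 'I_n -> R) :
  (k <= n)%N -> (forall i, 0 < y i) ->
  (forall a, (forall i, 0 < a i) -> e k a <= (\sum_i a i * y i) ^+ k) ->
  (forall i j, 0 <= P i j) ->
  (forall i, \sum_j P i j = 1) -> (forall j, \sum_i P i j = 1) ->
  e k (fun i => expR (l i)) <=
  (\sum_i expR (l i + \sum_j P i j * ln (y j))) ^+ k.
Proof.
case: k => [|k] kn y0 ye P0 Pr Pc; first by rewrite esym0 expr0.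
pose a i := expR (l i).
have a0 i : 0 < a i by exact: expR_gt0.
(* The partial derivative of [e k.+1 (exp l)] in [l i]; rearrangement makes the first-order effect
   of the move nonnegative. *)
pose u i := a i * esym ([set: 'I_n] :\ i) k a.
have [s us] := rearrangement u (fun j => ln (y j)) P0 Pr Pc.
pose m i := \sum_j P i j * ln (y j).
apply: (@le_trans _ _ (e k.+1 (fun i => expR (l i + (m i - ln (y (s i))))))).
  apply: esym_expR_ge; first by rewrite cardsT card_ord.
  rewrite /= -/a.
  have -> : \sum_(i in [set: 'I_n]) (m i - ln (y (s i))) * a i * esym ([set: 'I_n] :\ i) k a =
     \sum_i \sum_j P i j * (u i * ln (y j)) - \sum_i u i * ln (y (s i)).
    rewrite -sumrB; apply: eq_big => [i|i _]; first by rewrite finset.in_setT.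
    have uE : a i * esym ([set: 'I_n] :\ i) k a = u i by [].
    rewrite -mulrA uE mulrBl; congr (_ - _); last first. by rewrite mulrC.
    by rewrite mulr_suml; apply: eq_bigr => j _; rewrite -mulrA [u i * _]mulrC.
  by rewrite subr_ge0.
pose b i := expR (l i + m i) / y (s i).
have -> : e k.+1 (fun i => expR (l i + (m i - ln (y (s i))))) = e k.+1 b.
  congr (esym _ _ _); apply/funext => i.
  by rewrite addrA expRB lnK ?posrE.
rewrite -(esym_perm s^-1); apply: le_trans (ye _ _) _.
  by move=> i; rewrite /= /b divr_gt0 ?expR_gt0.
rewrite le_eqVlt; apply/orP; left; apply/eqP; congr (_ ^+ _).
rewrite (reindex_inj (@perm_inj _ s)) /=; apply: eq_bigr => i _.
by rewrite permK /b divfK // gt_eqF.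
Qed.

(** [y] is the gradient of [e k ^ (1/k)] at [b]. Garding's inequality gives the domination, and
    homogeneity of degree 1 the equality at [b]. *)
Lemma esym_supporting_linear k (b : 'I_n -> R) :
  (0 < k <= n)%N -> (forall i, 0 < b i) ->
  exists y : 'I_n -> R, [/\ forall i, 0 < y i,
    forall a, (forall i, 0 < a i) -> e k a <= (\sum_i a i * y i) ^+ k &
    e k b = (\sum_i b i * y i) ^+ k].
Proof.
move=> /andP[k0 kn] b0.
have kT : (k <= #|[set: 'I_n]|)%N by rewrite cardsT card_ord.
have eb := esym_gt0 b0 kT.
pose r := powR (e k b) k%:R^-1.
have r0 : 0 < r by exact: powR_gt0.
have rk : r ^+ k = e k b.
  rewrite -powR_mulrn ?ltW// -powRrM mulVf ?powRr1 ?ltW//.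
  by rewrite pnatr_eq0 -lt0n.
have kR : 0 < k%:R :> R by rewrite ltr0n.
(* The chain-rule factor [(1/k) * (e k b) ^ (1/k - 1)]. *)
pose c := r / (k%:R * e k b).
have c0 : 0 < c by rewrite divr_gt0 ?mulr_gt0.
exists (fun i => c * esym ([set: 'I_n] :\ i) k.-1 b).
have sumE a : \sum_i a i * (c * esym ([set: 'I_n] :\ i) k.-1 b) = c * desym [set: 'I_n] k a b.
  case: k k0 {kT kn eb r r0 rk kR} c c0 => // k _ c c0 /=.
  rewrite mulr_sumr; apply: eq_big => [i|i _]; first by rewrite finset.in_setT.
  by rewrite mulrCA.
split=> [i|a a0|].
- rewrite mulr_gt0 // esym_gt0 //.
  have := cardsD1 i [set: 'I_n]; rewrite cardsT card_ord finset.in_setT add1n => nE.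
  by rewrite -ltnS -nE prednK.
- have kk : (0 < k <= #|[set: 'I_n]|)%N by rewrite k0.
  have := esym_garding a0 b0 kk.
  rewrite sumE => h; rewrite exprMn /c expr_div_n rk.
  rewrite mulrAC ler_pdivlMr ?exprn_gt0 ?mulr_gt0 //.
  by rewrite [leRHS]mulrC.
- rewrite sumE -[LHS]rk; congr (_ ^+ _).
  have -> : desym [set: 'I_n] k b b = k%:R * e k b.
    by case: (k) k0 => // k' _ /=; rewrite -esym_euler.
  by rewrite divfK // gt_eqF // mulr_gt0.
Qed.

End KTraceScalar.

(** * Real traces and spectral sums *)

Local Open Scope sesquilinear_scope.
Local Open Scope complex_scope.

Section RealTrace.
Variable R : realType.
Local Notation C := R[i].

Lemma complex_ReD (x y : C) : complex.Re (x + y) = complex.Re x + complex.Re y.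
Proof. by case: x y => [? ?] [? ?]. Qed.

Lemma complex_Re_sum (I : Type) (r : seq I) (P : pred I) (F : I -> C) :
  complex.Re (\sum_(i <- r | P i) F i) = \sum_(i <- r | P i) complex.Re (F i).
Proof. exact: (big_morph _ complex_ReD). Qed.

Lemma complex_ReZ (t : R) (x : C) : complex.Re (t%:C * x) = t * complex.Re x.
Proof. by case: x => a b /=; rewrite mul0r subr0. Qed.

Variable n : nat.
Implicit Types (A B M N U V X : 'M[C]_n) (x a : 'rV[R]_n).

Definition rtr A : R := complex.Re (\tr A).

Lemma rtrD A B : rtr (A + B) = rtr A + rtr B.
Proof. by rewrite /rtr mxtraceD complex_ReD. Qed.

Lemma rtrZ (t : R) A : rtr (t%:C *: A) = t * rtr A.
Proof. by rewrite /rtr mxtraceZ complex_ReZ. Qed.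

Local Notation diagC x := (diag_mx (map_mx (real_complex R) x)).

Lemma diagC1 : diagC (const_mx 1) = 1%:M :> 'M[C]_n.
Proof. by apply/matrixP => i j; rewrite !mxE rmorph1. Qed.

Lemma rtr_diag2 M N x a :
  rtr (M ^t* *m diagC x *m N *m diagC a) =
  \sum_i \sum_j x 0 i * a 0 j * complex.Re (Num.conj (M i j) * N i j).
Proof.
rewrite /rtr /mxtrace complex_Re_sum [RHS]exchange_big /=; apply: eq_bigr => j _.
rewrite mul_mx_diag !mxE mulr_suml complex_Re_sum; apply: eq_bigr => i _.
rewrite mul_mx_diag !mxE -complex_ReZ; congr complex.Re.
by rewrite rmorphM /= ; ring.
Qed.

Definition specmx U x : 'M[C]_n := U ^t* *m diagC x *m U.

Lemma spectral_fun_specmx (f : R -> R) U x : U \is unitarymx ->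
  spectral_fun f (specmx U x) = specmx U (map_mx f x).
Proof.
move=> Uu; rewrite /specmx (spectral_funE f x Uu).
suff -> : map_mx (real_complex R) (map_mx f x) = map_mx (fun p => (f p)%:C) x by [].
by apply/matrixP => i j; rewrite !mxE.
Qed.

Definition eigval A : 'rV[R]_n := map_mx (@complex.Re R) (spectral_diag A).

Lemma spectral_fun_eigval (f : R -> R) A :
  spectral_fun f A = specmx (spectralmx A) (map_mx f (eigval A)).
Proof.
rewrite /spectral_fun /specmx.
suff -> : map_mx (real_complex R) (map_mx f (eigval A)) =
  map_mx (fun z => (f (complex.Re z))%:C) (spectral_diag A) by [].
by apply/matrixP => i j; rewrite !mxE.
Qed.

Lemma hermE A : A \is hermsymmx -> A = specmx (spectralmx A) (eigval A).
Proof.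
move=> hA; have /orthomx_spectralP := hermitian_normalmx hA.
rewrite invmx_unitary ?spectral_unitarymx // => AE.
rewrite /specmx; suff -> : map_mx (real_complex R) (eigval A) = spectral_diag A by [].
apply/matrixP => i j; rewrite !mxE ord1.
have /mxOverP/(_ 0 j) := hermitian_spectral_diag_real hA.
by move=> /RRe_real.
Qed.

Lemma spectral_fun_id A : A \is hermsymmx -> spectral_fun id A = A.
Proof.
move=> hA; rewrite [RHS](hermE hA) spectral_fun_eigval.
by congr specmx; apply/matrixP => i j; rewrite !mxE.
Qed.

Lemma spectral_fun_comp (f g : R -> R) A :
  spectral_fun g (spectral_fun f A) = spectral_fun (g \o f) A.
Proof.
rewrite [spectral_fun f A]spectral_fun_eigval (spectral_fun_specmx _ _ (spectral_unitarymx A)).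
rewrite spectral_fun_eigval; congr specmx.
by apply/matrixP => i j; rewrite !mxE.
Qed.

Lemma spectral_fun1 A : spectral_fun (fun=> 1) A = 1%:M.
Proof.
rewrite spectral_fun_eigval.
have -> : map_mx (fun=> 1) (eigval A) = const_mx 1 :> 'rV[R]_n.
  by apply/matrixP => i j; rewrite !mxE.
rewrite /specmx diagC1 mulmx1.
by apply: mulmx1C; apply/unitarymxP; exact: spectral_unitarymx.
Qed.

(** The squared modulus of the inner product of the [i]-th vector of one basis with the [j]-th of
    the other; a unistochastic matrix when [U] and [V] are unitary. *)
Definition overlap U V (i j : 'I_n) : R :=
  complex.Re (Num.conj ((U *m V ^t*) i j) * (U *m V ^t*) i j).

Lemma complex_Re_normsq (z : C) :
  complex.Re (Num.conj z * z) = complex.Re z ^+ 2 + complex.Im z ^+ 2.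
Proof. by case: z => p q /=; rewrite mulNr opprK. Qed.

Lemma overlap_ge0 U V i j : 0 <= overlap U V i j.
Proof. by rewrite /overlap complex_Re_normsq addr_ge0 ?sqr_ge0. Qed.

Lemma rtr_specmx_mul U V x a :
  rtr (specmx U x *m specmx V a) =
  \sum_i \sum_j x 0 i * a 0 j * overlap U V i j.
Proof.
rewrite -rtr_diag2 /rtr; congr complex.Re.
rewrite /specmx !mulmxA mxtrace_mulC !mulmxA.
by rewrite trmx_mul map_mxM trmxCK.
Qed.

Lemma rtr_specmx U x : U \is unitarymx -> rtr (specmx U x) = \sum_i x 0 i.
Proof.
move=> /unitarymxP UU; rewrite /rtr /specmx mxtrace_mulC !mulmxA UU mul1mx.
rewrite mxtrace_diag complex_Re_sum.
by apply: eq_bigr => i _; rewrite !mxE.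
Qed.

Lemma overlap_row U V i : U \is unitarymx -> V \is unitarymx ->
  \sum_j overlap U V i j = 1.
Proof.
move=> Uu Vu; have Wu : U *m V ^t* \is unitarymx.
  by apply: (mul_unitarymx Uu); rewrite trmxC_unitary.
have /unitarymxP/matrixP/(_ i i) := Wu.
rewrite !mxE eqxx => /(congr1 (@complex.Re R)); rewrite complex_Re_sum /= => <-.
by apply: eq_bigr => j _; rewrite /overlap !mxE mulrC.
Qed.

Lemma overlap_col U V j : U \is unitarymx -> V \is unitarymx ->
  \sum_i overlap U V i j = 1.
Proof.
move=> Uu Vu; have /unitarymxP : (U *m V ^t*) ^t* \is unitarymx.
  by rewrite trmxC_unitary; apply: (mul_unitarymx Uu); rewrite trmxC_unitary.
rewrite trmxCK => /matrixP/(_ j j).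
rewrite !mxE eqxx => /(congr1 (@complex.Re R)); rewrite complex_Re_sum /= => <-.
by apply: eq_bigr => i _; rewrite /overlap !mxE.
Qed.

(* [dsum f X A] is [\sum_ij |<u_i, v_j>|^2 f(x_i, a_j)], a double operator
   integral over the spectra of [X] and [A]. *)
Definition dsum (f : R -> R -> R) X A : R :=
  \sum_i \sum_j overlap (spectralmx X) (spectralmx A) i j *
    f (eigval X 0 i) (eigval A 0 j).

Lemma dsumD f g X A :
  dsum (fun p q => f p q + g p q) X A = dsum f X A + dsum g X A.
Proof.
rewrite /dsum -big_split; apply: eq_bigr => i _ /=.
by rewrite -big_split; apply: eq_bigr => j _ /=; rewrite mulrDr.
Qed.

Lemma dsumZ (c : R) f X A : dsum (fun p q => c * f p q) X A = c * dsum f X A.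
Proof.
rewrite /dsum mulr_sumr; apply: eq_bigr => i _.
by rewrite mulr_sumr; apply: eq_bigr => j _; rewrite mulrCA.
Qed.

Lemma dsumM f g X A :
  dsum (fun p q => f p * g q) X A = rtr (spectral_fun f X *m spectral_fun g A).
Proof.
rewrite !spectral_fun_eigval rtr_specmx_mul; apply: eq_bigr => i _.
by apply: eq_bigr => j _; rewrite !mxE mulrC.
Qed.

Lemma dsuml f X A : dsum (fun p _ => f p) X A = rtr (spectral_fun f X).
Proof.
rewrite -[spectral_fun f X]mulmx1 -(spectral_fun1 A) -dsumM.
by congr dsum; apply/funext => p; apply/funext => q; rewrite mulr1.
Qed.

Lemma dsumr f X A : dsum (fun _ q => f q) X A = rtr (spectral_fun f A).
Proof.
rewrite -[spectral_fun f A]mul1mx -(spectral_fun1 X) -dsumM.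
by congr dsum; apply/funext => p; apply/funext => q; rewrite mul1r.
Qed.

(** The mechanism of Klein's inequality: overlaps are nonnegative, so a scalar inequality on pairs
    of eigenvalues becomes a trace inequality. *)
Lemma ler_dsum f g X A :
  (forall i j, f (eigval X 0 i) (eigval A 0 j) <= g (eigval X 0 i) (eigval A 0 j)) ->
  dsum f X A <= dsum g X A.
Proof.
move=> fg; apply: ler_sum => i _; apply: ler_sum => j _.
by rewrite ler_wpM2l ?overlap_ge0.
Qed.

Lemma posdefmx_herm A : posdefmx A -> A \is hermsymmx.
Proof. by case. Qed.

Lemma posdefmx_eigval_gt0 A i : posdefmx A -> 0 < eigval A 0 i.
Proof.
move=> [hA pA]; set U := spectralmx A.
have UU : U *m U ^t* = 1%:M by apply/unitarymxP; exact: spectral_unitarymx.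
pose v : 'cV[C]_n := U ^t* *m delta_mx i 0.
have Uv : U *m v = delta_mx i 0 by rewrite mulmxA UU mul1mx.
have v0 : v != 0.
  apply/eqP => v0; move: Uv; rewrite v0 mulmx0 => /matrixP/(_ i 0).
  by rewrite !mxE !eqxx => /eqP; rewrite eq_sym oner_eq0.
have := pA _ v0; rewrite {1}(hermE hA) -/U /specmx.
have -> : v ^t* *m (U ^t* *m diagC (eigval A) *m U) *m v =
  (U *m v) ^t* *m diagC (eigval A) *m (U *m v).
  by rewrite !trmx_mul !map_mxM !mulmxA.
rewrite Uv mxE (bigD1 i) //= big1 ?addr0; last first.
  by move=> j /negbTE ji; rewrite [X in _ * X]mxE ji mulr0.
by rewrite mul_mx_diag !mxE !eqxx /= rmorph1 mul1r mulr1 ltcR.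
Qed.

Lemma specmx_posdef U x : U \is unitarymx -> (forall i, 0 < x 0 i) ->
  posdefmx (specmx U x).
Proof.
move=> Uu x0; split.
  have -> : specmx U x = spectral_fun id (specmx U x).
    rewrite (spectral_fun_specmx _ _ Uu); congr specmx.
    by apply/matrixP => i j; rewrite !mxE.
  exact: spectral_fun_herm.
move=> v v0.
have -> : v ^t* *m specmx U x *m v = (U *m v) ^t* *m diagC x *m (U *m v).
  by rewrite /specmx !trmx_mul !map_mxM !mulmxA.
have Uv0 : U *m v != 0.
  apply: contraNneq v0 => Uv; rewrite -[v]mul1mx.
  by rewrite -(mulmx1C (unitarymxP Uu)) -mulmxA Uv mulmx0.
have [i wi] : exists i, (U *m v) i 0 != 0.
  apply/existsP; apply: contraNT Uv0; rewrite negb_exists => /forallP w0.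
  by apply/eqP/colP => i; rewrite [RHS]mxE; apply/eqP; rewrite -[_ == _]negbK w0.
move: (U *m v) wi => w wi.
have term j : (w ^t* *m diagC x) 0 j * w j 0 = (x 0 j)%:C * (w j 0 * Num.conj (w j 0)).
  by rewrite mul_mx_diag !mxE; ring.
rewrite mxE (bigD1 i) //= ltr_wpDr //.
  by apply: sumr_ge0 => j _; rewrite term mulr_ge0 ?mul_conjC_ge0 // ler0c ltW.
by rewrite term mulr_gt0 ?ltcR // lt0r mul_conjC_ge0 mul_conjC_eq0 wi.
Qed.

Lemma expmx_posdef A : posdefmx (expmx A).
Proof.
rewrite /expmx spectral_fun_eigval; apply: specmx_posdef.
  exact: spectral_unitarymx.
by move=> i; rewrite mxE expR_gt0.
Qed.

Lemma lnmx_expmx A : A \is hermsymmx -> lnmx (expmx A) = A.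
Proof.
move=> hA; rewrite /lnmx /expmx spectral_fun_comp -[RHS](spectral_fun_id hA).
by congr spectral_fun; apply/funext => x; rewrite /= expRK.
Qed.

Lemma herm_add A B : A \is hermsymmx -> B \is hermsymmx -> A + B \is hermsymmx.
Proof.
move=> /is_hermitianmxP + /is_hermitianmxP.
rewrite !expr0 !scale1r => hA hB; apply/is_hermitianmxP.
by rewrite expr0 scale1r linearD map_mxD -hA -hB.
Qed.

End RealTrace.

(** * Lieb's concavity theorem *)

Section QuadOverLinear.
Variables (R : realType) (n : nat).
Local Notation C := R[i].
Implicit Types (A X K M U V : 'M[C]_n) (x a : 'rV[R]_n) (p q t : R).

Local Notation diagC x := (diag_mx (map_mx (real_complex R) x)).

(** The operator version of [2 k c - k ^ 2 d], whose supremum over [k] is [c ^ 2 / d]: here [d] is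
    the map sending [K] to [p X K + q K A]. For fixed [K] it is linear in [(X, A)]. *)
Definition quad_form p q K X A : R :=
  2 * rtr (K ^t* *m X) -
  (p * rtr (K ^t* *m X *m K) + q * rtr (K ^t* *m K *m A)).

Definition quad_dsum p q := @dsum R n (fun c d => c ^+ 2 / (p * c + q * d)).

(** For [p = N - m] and [q = m], the integrand is a term of a Riemann sum for
    [c * (ln d - ln c)]. *)
Definition mobius_dsum p q :=
  @dsum R n (fun c d => c * (d - c) / (p * c + q * d)).

(** In the eigenbases of the two matrices the entries of [K] decouple, so each can be optimised
    separately. *)
Lemma quad_form_specmx p q U V M x a : U \is unitarymx -> V \is unitarymx ->
  quad_form p q (U ^t* *m M *m V) (specmx U x) (specmx V a) =
  \sum_i \sum_j (2 * (x 0 i * complex.Re (Num.conj (M i j) * (U *m V ^t*) i j)) -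
    (p * x 0 i + q * a 0 j) * complex.Re (Num.conj (M i j) * M i j)).
Proof.
move=> /unitarymxP UU /unitarymxP VV; rewrite /quad_form.
have KE : (U ^t* *m M *m V) ^t* = V ^t* *m M ^t* *m U.
  by rewrite !trmx_mul !map_mxM trmxCK mulmxA.
have VK (B : 'M[C]_n) : B *m V *m V ^t* = B by rewrite -mulmxA VV mulmx1.
have -> : rtr ((U ^t* *m M *m V) ^t* *m specmx U x) =
  \sum_i \sum_j x 0 i * complex.Re (Num.conj (M i j) * (U *m V ^t*) i j).
  transitivity (rtr (M ^t* *m diagC x *m (U *m V ^t*) *m diagC (const_mx 1))).
    rewrite diagC1 mulmx1 KE /specmx /rtr -!mulmxA (mulmxA U) UU mul1mx.
    by rewrite mxtrace_mulC !mulmxA.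
  rewrite rtr_diag2; apply: eq_bigr => i _; apply: eq_bigr => j _.
  by rewrite [const_mx _ _ _]mxE mulr1.
have -> : rtr ((U ^t* *m M *m V) ^t* *m specmx U x *m (U ^t* *m M *m V)) =
  \sum_i \sum_j x 0 i * complex.Re (Num.conj (M i j) * M i j).
  transitivity (rtr (M ^t* *m diagC x *m M *m diagC (const_mx 1))).
    rewrite diagC1 mulmx1 KE /specmx /rtr -!mulmxA (mulmxA U) UU mul1mx.
    rewrite (mulmxA U) UU mul1mx mxtrace_mulC !mulmxA VK.
    by [].
  rewrite rtr_diag2; apply: eq_bigr => i _; apply: eq_bigr => j _.
  by rewrite [const_mx _ _ _]mxE mulr1.
have -> : rtr ((U ^t* *m M *m V) ^t* *m (U ^t* *m M *m V) *m specmx V a) =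
  \sum_i \sum_j a 0 j * complex.Re (Num.conj (M i j) * M i j).
  transitivity (rtr (M ^t* *m diagC (const_mx 1) *m M *m diagC a)).
    rewrite diagC1 mulmx1 KE /specmx /rtr -!mulmxA (mulmxA U) UU mul1mx.
    rewrite (mulmxA V) VV mul1mx mxtrace_mulC !mulmxA VK.
    by [].
  rewrite rtr_diag2; apply: eq_bigr => i _; apply: eq_bigr => j _.
  by rewrite [const_mx _ _ _]mxE mul1r.
rewrite !mulr_sumr -!big_split -sumrB; apply: eq_bigr => i _ /=.
rewrite !mulr_sumr -!big_split -sumrB; apply: eq_bigr => j _ /=.
by ring.
Qed.

(** Completing the square in [k]. Equality holds at [k = c w / d], the choice made entrywise in
    [quad_form_attained]. *)
Lemma complex_square_le (k w : C) (c d : R) : 0 < d ->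
  2 * (c * complex.Re (Num.conj k * w)) - d * complex.Re (Num.conj k * k) <=
  complex.Re (Num.conj w * w) * (c ^+ 2 / d).
Proof.
move=> d0; case: k w => [k1 k2] [w1 w2] /=.
rewrite [leRHS]mulrA ler_pdivlMr // -subr_ge0.
rewrite (_ : _ - _ = (d * k1 - c * w1) ^+ 2 + (d * k2 - c * w2) ^+ 2); last by ring.
by rewrite addr_ge0 ?sqr_ge0.
Qed.

Lemma pos_combination (p q c d : R) :
  0 <= p -> 0 <= q -> 0 < p + q -> 0 < c -> 0 < d -> 0 < p * c + q * d.
Proof.
move=> p0 q0 pq c0 d0; move: p0; rewrite le0r => /orP[/eqP p0|p0].
  by move: pq; rewrite p0 add0r mul0r add0r => q1; rewrite mulr_gt0.
by rewrite ltr_wpDr ?mulr_gt0 // mulr_ge0 // ltW.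
Qed.

Lemma spectralmx_sandwichK X A K :
  (spectralmx X) ^t* *m (spectralmx X *m K *m (spectralmx A) ^t*) *m spectralmx A = K.
Proof.
rewrite !mulmxA (mulmx1C (unitarymxP (spectral_unitarymx X))) mul1mx -mulmxA.
by rewrite (mulmx1C (unitarymxP (spectral_unitarymx A))) mulmx1.
Qed.

Lemma quad_form_herm p q M X A : X \is hermsymmx -> A \is hermsymmx ->
  quad_form p q ((spectralmx X) ^t* *m M *m spectralmx A) X A =
  \sum_i \sum_j (2 * (eigval X 0 i *
      complex.Re (Num.conj (M i j) * (spectralmx X *m (spectralmx A) ^t*) i j)) -
    (p * eigval X 0 i + q * eigval A 0 j) * complex.Re (Num.conj (M i j) * M i j)).
Proof.
move=> hX hA.
have := quad_form_specmx p q M (eigval X) (eigval A) (spectral_unitarymx X)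
  (spectral_unitarymx A).
by rewrite -(hermE hX) -(hermE hA).
Qed.

Lemma quad_form_le p q K X A : posdefmx X -> posdefmx A ->
  0 <= p -> 0 <= q -> 0 < p + q ->
  quad_form p q K X A <= quad_dsum p q X A.
Proof.
move=> pX pA p0 q0 pq.
rewrite -(spectralmx_sandwichK X A K).
rewrite (quad_form_herm _ _ _ (posdefmx_herm pX) (posdefmx_herm pA)).
apply: ler_sum => i _; apply: ler_sum => j _; apply: complex_square_le.
by apply: pos_combination => //; exact: posdefmx_eigval_gt0.
Qed.

Lemma quad_form_attained p q X A : posdefmx X -> posdefmx A ->
  0 <= p -> 0 <= q -> 0 < p + q ->
  exists K, quad_form p q K X A = quad_dsum p q X A.
Proof.
move=> pX pA p0 q0 pq.
pose W := spectralmx X *m (spectralmx A) ^t*.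
pose d i j := p * eigval X 0 i + q * eigval A 0 j.
pose M : 'M[C]_n := \matrix_(i, j) ((eigval X 0 i / d i j)%:C * W i j).
exists ((spectralmx X) ^t* *m M *m spectralmx A).
rewrite (quad_form_herm _ _ _ (posdefmx_herm pX) (posdefmx_herm pA)).
apply: eq_bigr => i _; apply: eq_bigr => j _; rewrite -/W -/(d i j).
have d0 : 0 < d i j.
  by apply: pos_combination => //; exact: posdefmx_eigval_gt0.
rewrite /overlap -/W [M i j]mxE; case: (W i j) => w1 w2 /=.
by field; rewrite gt_eqF.
Qed.

Definition mix t A B : 'M[C]_n := t%:C *: A + (1 - t)%:C *: B.

Lemma rtr_mix t A B : rtr (mix t A B) = t * rtr A + (1 - t) * rtr B.
Proof. by rewrite /mix rtrD !rtrZ. Qed.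

Lemma rtr_mulmx_mix t M A B :
  rtr (M *m mix t A B) = t * rtr (M *m A) + (1 - t) * rtr (M *m B).
Proof. by rewrite /mix mulmxDr rtrD -!scalemxAr !rtrZ. Qed.

Lemma quad_form_mix p q t K X1 X2 A1 A2 :
  quad_form p q K (mix t X1 X2) (mix t A1 A2) =
  t * quad_form p q K X1 A1 + (1 - t) * quad_form p q K X2 A2.
Proof.
rewrite /quad_form !rtr_mulmx_mix.
have -> : rtr (K ^t* *m mix t X1 X2 *m K) =
  t * rtr (K ^t* *m X1 *m K) + (1 - t) * rtr (K ^t* *m X2 *m K).
  by rewrite /mix mulmxDr mulmxDl -!scalemxAr -!scalemxAl rtrD !rtrZ.
by ring.
Qed.

Lemma dsum_quad_convex p q t X1 X2 A1 A2 :
  posdefmx X1 -> posdefmx X2 -> posdefmx A1 -> posdefmx A2 -> 0 <= t <= 1 ->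
  0 <= p -> 0 <= q -> 0 < p + q ->
  quad_dsum p q (mix t X1 X2) (mix t A1 A2) <=
  t * quad_dsum p q X1 A1 + (1 - t) * quad_dsum p q X2 A2.
Proof.
move=> pX1 pX2 pA1 pA2 t01 p0 q0 pq.
(* The maximiser at the mixture is a mere competitor at the two endpoints. *)
have [K KE] := quad_form_attained (posdefmx_convex pX1 pX2 t01)
  (posdefmx_convex pA1 pA2 t01) p0 q0 pq.
rewrite /mix -KE -/(mix t X1 X2) -/(mix t A1 A2) quad_form_mix.
move: t01 => /andP[t0 t1]; rewrite -subr_ge0 in t1.
by apply: lerD; apply: ler_wpM2l => //; exact: quad_form_le.
Qed.

(* For [q > 0] the integrand is [(c - (p + q) c^2 / (p c + q d)) / q]. *)
Lemma dsum_mobius_concave p q t X1 X2 A1 A2 :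
  posdefmx X1 -> posdefmx X2 -> posdefmx A1 -> posdefmx A2 -> 0 <= t <= 1 ->
  0 < p -> 0 <= q ->
  t * mobius_dsum p q X1 A1 + (1 - t) * mobius_dsum p q X2 A2 <=
  mobius_dsum p q (mix t X1 X2) (mix t A1 A2).
Proof.
move=> pX1 pX2 pA1 pA2 t01 p0 q0.
have pXm := posdefmx_convex pX1 pX2 t01; have pAm := posdefmx_convex pA1 pA2 t01.
rewrite -/(mix t X1 X2) -/(mix t A1 A2) in pXm pAm.
have tr_id X : posdefmx X -> rtr (spectral_fun id X) = rtr X.
  by move=> pX; rewrite (spectral_fun_id (posdefmx_herm pX)).
(* For [q = 0], the term [m = 0] of the Riemann sum, the integrand is [(d - c) / p] and the sum is
   linear in [(X, A)]. *)
move: q0; rewrite le0r => /orP[/eqP q0|q0].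
  have SE X A : posdefmx X -> posdefmx A ->
      mobius_dsum p q X A = p^-1 * (rtr A - rtr X).
    move=> pX pA.
    transitivity (dsum (fun c d => p^-1 * d + (- p^-1) * c) X A).
      apply: eq_bigr => i _; apply: eq_bigr => j _; congr (_ * _).
      have := posdefmx_eigval_gt0 i pX; rewrite q0; set c := eigval X _ _ => c0.
      by field; rewrite !gt_eqF.
    rewrite dsumD (dsumZ _ (fun _ d => d)) (dsumZ _ (fun c _ => c)).
    by rewrite (dsumr id) (dsuml id) !tr_id // mulNr mulrBr.
  by rewrite !SE // !rtr_mix le_eqVlt; apply/orP; left; apply/eqP; ring.
have SE X A : posdefmx X -> posdefmx A ->
    mobius_dsum p q X A =
    q^-1 * rtr X - (p + q) / q * quad_dsum p q X A.
  move=> pX pA.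
  transitivity (dsum (fun c d => q^-1 * c +
      (- ((p + q) / q)) * (c ^+ 2 / (p * c + q * d))) X A).
    apply: eq_bigr => i _; apply: eq_bigr => j _; congr (_ * _).
    have := posdefmx_eigval_gt0 i pX; have := posdefmx_eigval_gt0 j pA.
    set c := eigval X _ _; set d := eigval A _ _ => d0 c0.
    have h : 0 < p * c + q * d by rewrite addr_gt0 ?mulr_gt0.
    by field; rewrite !gt_eqF.
  rewrite dsumD (dsumZ _ (fun c _ => c)) dsumZ.
  by rewrite (dsuml id) !tr_id // mulNr.
rewrite !SE // rtr_mix.
have := dsum_quad_convex pX1 pX2 pA1 pA2 t01 (ltW p0) (ltW q0) (addr_gt0 p0 q0).
set Q := quad_dsum p q; move=> h.
have pq : 0 <= (p + q) / q by rewrite divr_ge0 ?ltW // addr_gt0.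
rewrite -subr_ge0.
rewrite (_ : _ - _ = (p + q) / q * (t * Q X1 A1 + (1 - t) * Q X2 A2 -
  Q (mix t X1 X2) (mix t A1 A2))); last by ring.
by rewrite mulr_ge0 // subr_ge0.
Qed.

End QuadOverLinear.

(** * Joint concavity of the relative entropy term, Gibbs' principle and Lieb's theorem *)

Section Lieb.
Variables (R : realType) (n : nat).
Local Notation C := R[i].
Implicit Types (A X L H U V : 'M[C]_n) (c d t : R).

Lemma ln_sub_le c d : 0 < c -> 0 < d -> ln d - ln c <= (d - c) / c.
Proof.
move=> c0 d0; have := expR_ge1Dx (ln d - ln c).
rewrite expRD expRN !lnK ?posrE // => h.
by rewrite mulrBl divff ?gt_eqF // lerBrDl.
Qed.

(* The interpolants [c_m = (N - m) c + m d] have increments [d - c], and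
   [(d - c) / c_m >= ln c_m.+1 - ln c_m >= (d - c) / c_m.+1]. *)
Lemma mobius_sum_bounds (N : nat) c d : 0 < c -> 0 < d -> (0 < N)%N ->
  c * (ln d - ln c) <=
    \sum_(m < N) c * (d - c) / ((N%:R - m%:R) * c + m%:R * d) <=
    c * (ln d - ln c) + N%:R^-1 * ((d - c) ^+ 2 / d).
Proof.
move=> c0 d0 N0; pose w (m : nat) : R := (N%:R - m%:R) * c + m%:R * d.
have NR : 0 < N%:R :> R by rewrite ltr0n.
have w0 m : (m <= N)%N -> 0 < w m.
  by move=> mN; apply: pos_combination; rewrite ?subr_ge0 ?ler_nat ?ler0n ?subrK.
have wS m : w m.+1 - w m = d - c by rewrite /w -natr1; ring.
have lnE : ln d - ln c = \sum_(0 <= m < N) (ln (w m.+1) - ln (w m)).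
  rewrite telescope_sumr // /w subrr mul0r add0r subr0 mul0r addr0.
  by rewrite !lnM ?posrE //; ring.
have sumE : \sum_(m < N) c * (d - c) / ((N%:R - m%:R) * c + m%:R * d) =
    c * \sum_(0 <= m < N) (d - c) / w m.
  by rewrite big_mkord mulr_sumr; apply: eq_bigr => m _; rewrite -mulrA.
rewrite sumE lnE; apply/andP; split.
  apply: ler_wpM2l; first exact: ltW.
  rewrite !big_mkord; apply: ler_sum => m _.
  by rewrite -(wS m); apply: ln_sub_le; apply: w0 => //; exact: ltnW.
(* The gap between the two Riemann sums telescopes to the end terms, with [w 0 = N c] and
   [w N = N d]. *)
have -> : N%:R^-1 * ((d - c) ^+ 2 / d) =
    c * (\sum_(0 <= m < N) (d - c) / w m - \sum_(0 <= m < N) (d - c) / w m.+1).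
  rewrite -sumrB; under eq_bigr do rewrite -opprB.
  rewrite sumrN (telescope_sumr (fun m => (d - c) / w m)) // /w subrr mul0r add0r subr0 mul0r addr0.
  by field; rewrite !gt_eqF.
rewrite -mulrDr; apply: ler_wpM2l; first exact: ltW.
rewrite addrCA lerDl subr_ge0 !big_mkord.
apply: ler_sum => m _; have mN := ltn_ord m.
have := ln_sub_le (w0 _ mN) (w0 _ (ltnW mN)).
by rewrite -[w m - _]opprB wS mulNr -opprB lerN2.
Qed.

(** Minus the Umegaki relative entropy of [X] with respect to [A]; [entropy_dsum_rtr] gives the
    trace form. *)
Definition entropy_dsum X A : R := dsum (fun c d => c * (ln d - ln c)) X A.

Lemma mobius_dsum_bounds (N : nat) X A : posdefmx X -> posdefmx A -> (0 < N)%N ->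
  entropy_dsum X A <= \sum_(m < N) mobius_dsum (N%:R - m%:R) m%:R X A <=
  entropy_dsum X A + N%:R^-1 * dsum (fun c d => (d - c) ^+ 2 / d) X A.
Proof.
move=> pX pA N0.
have -> : \sum_(m < N) mobius_dsum (N%:R - m%:R) m%:R X A =
    dsum (fun c d => \sum_(m < N) c * (d - c) / ((N%:R - m%:R) * c + m%:R * d)) X A.
  rewrite exchange_big; apply: eq_bigr => i _ /=.
  by rewrite exchange_big; apply: eq_bigr => j _; rewrite -mulr_sumr.
rewrite -dsumZ -dsumD; apply/andP; split; apply: ler_dsum => i j;
  by have /andP[] := mobius_sum_bounds (posdefmx_eigval_gt0 i pX)
    (posdefmx_eigval_gt0 j pA) N0.
Qed.

(** The approximating sums are concave. Their lower bound is used at the endpoints and their upper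
    bound at the mixture, which leaves an error [D / N]. *)
Lemma entropy_dsum_concave t X1 X2 A1 A2 :
  posdefmx X1 -> posdefmx X2 -> posdefmx A1 -> posdefmx A2 -> 0 <= t <= 1 ->
  t * entropy_dsum X1 A1 + (1 - t) * entropy_dsum X2 A2 <=
  entropy_dsum (mix t X1 X2) (mix t A1 A2).
Proof.
move=> pX1 pX2 pA1 pA2 t01.
have pX := posdefmx_convex pX1 pX2 t01; have pA := posdefmx_convex pA1 pA2 t01.
rewrite -/(mix t X1 X2) -/(mix t A1 A2) in pX pA.
set X := mix t X1 X2 in pX *; set A := mix t A1 A2 in pA *.
pose D := dsum (fun c d => (d - c) ^+ 2 / d) X A.
have bound (N : nat) : (0 < N)%N ->
    t * entropy_dsum X1 A1 + (1 - t) * entropy_dsum X2 A2 <=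
    entropy_dsum X A + N%:R^-1 * D.
  move=> N0; have /andP[_] := mobius_dsum_bounds pX pA N0; apply: le_trans.
  have /andP[h1 _] := mobius_dsum_bounds pX1 pA1 N0.
  have /andP[h2 _] := mobius_dsum_bounds pX2 pA2 N0.
  have /andP[t0 t1] := t01; rewrite -subr_ge0 in t1.
  apply: le_trans (lerD (ler_wpM2l t0 h1) (ler_wpM2l t1 h2)) _.
  rewrite !mulr_sumr -big_split; apply: ler_sum => m _ /=.
  by apply: dsum_mobius_concave; rewrite ?subr_gt0 ?ltr_nat.
rewrite leNgt; apply/negP; set lhs := (X in _ < X) => lt.
have D0 : 0 <= D.
  apply: sumr_ge0 => i _; apply: sumr_ge0 => j _.
  by rewrite mulr_ge0 ?overlap_ge0 // divr_ge0 ?sqr_ge0 // ltW // posdefmx_eigval_gt0.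
rewrite -subr_gt0 in lt.
(* A violation by some positive amount is refuted by taking [N] larger than [D] divided by that
   amount. *)
have := archi_boundP (divr_ge0 D0 (ltW lt)).
set N := Num.bound _ => DN.
have N0 : (0 < N)%N.
  by rewrite -(ltr0n R); apply: le_lt_trans DN; rewrite divr_ge0 // ltW.
have := bound N N0; rewrite -/lhs -lerBlDl leNgt => /negP; apply.
by rewrite mulrC ltr_pdivrMr ?ltr0n // mulrC -ltr_pdivrMr.
Qed.

Lemma entropy_dsumE X A :
  entropy_dsum X A = rtr (spectral_fun id X *m lnmx A) - rtr (spectral_fun (fun c => c * ln c) X).
Proof.
rewrite -dsumM -(dsuml _ X A) -mulN1r -dsumZ -dsumD.
by congr dsum; apply/funext => c; apply/funext => d; rewrite mulN1r mulrBr.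
Qed.

Lemma spectral_funM (f g : R -> R) A :
  spectral_fun f A *m spectral_fun g A = spectral_fun (fun c => f c * g c) A.
Proof.
have UU := unitarymxP (spectral_unitarymx A).
rewrite !spectral_fun_eigval /specmx -!mulmxA (mulmxA (spectralmx A)) UU mul1mx.
rewrite (mulmxA (diag_mx _)) mulmx_diag.
suff -> : map_mx (real_complex R) (map_mx (fun c => f c * g c) (eigval A)) =
  \row_j (map_mx (real_complex R) (map_mx f (eigval A)) 0 j *
          map_mx (real_complex R) (map_mx g (eigval A)) 0 j) by [].
by apply/matrixP => i j; rewrite !mxE !ord1 rmorphM.
Qed.

Lemma entropy_dsum_rtr X A : posdefmx X ->
  entropy_dsum X A = rtr (X *m lnmx A) - rtr (X *m lnmx X).
Proof.
move=> /posdefmx_herm/spectral_fun_id idX.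
have -> : X *m lnmx X = spectral_fun (fun c => c * ln c) X.
  by rewrite -{1}idX spectral_funM.
by rewrite entropy_dsumE idX.
Qed.

(** By [ler_dsum] this is Young's inequality [c * l - c * ln c + c <= expR l] on pairs of
    eigenvalues. The term [rtr X] appears because the trace of [X] is not normalised. *)
Lemma gibbs_le X L : posdefmx X -> L \is hermsymmx ->
  rtr (X *m L) - rtr (X *m lnmx X) + rtr X <= rtr (expmx L).
Proof.
move=> pX hL; have idX := spectral_fun_id (posdefmx_herm pX).
have -> : rtr (X *m L) = dsum (fun c l => c * l) X L.
  by rewrite (dsumM id id) idX (spectral_fun_id hL).
have -> : rtr (X *m lnmx X) = dsum (fun c _ => c * ln c) X L.
  by rewrite (dsuml (fun c => c * ln c)) -{1}idX spectral_funM.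
have -> : rtr X = dsum (fun c _ => c) X L by rewrite (dsuml id) idX.
rewrite -(dsumr expR X L) -mulN1r -dsumZ -!dsumD; apply: ler_dsum => i j.
have := posdefmx_eigval_gt0 i pX; set c := eigval X _ _; set l := eigval L _ _ => c0.
have := expR_ge1Dx (l - ln c); rewrite expRD expRN lnK ?posrE // ler_pdivlMr //.
by apply: le_trans; rewrite le_eqVlt; apply/orP; left; apply/eqP; ring.
Qed.

Lemma rtr_mulC A X : rtr (A *m X) = rtr (X *m A).
Proof. by rewrite /rtr mxtrace_mulC. Qed.

Lemma lnmx_herm A : lnmx A \is hermsymmx.
Proof. exact: spectral_fun_herm. Qed.

(* Gibbs' variational principle writes [rtr (expmx (H + lnmx A))] as the supremum
   over [X] of a function which is jointly concave in [(X, A)]. *)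
Theorem lieb_concave t H A1 A2 : H \is hermsymmx ->
  posdefmx A1 -> posdefmx A2 -> 0 <= t <= 1 ->
  t * rtr (expmx (H + lnmx A1)) + (1 - t) * rtr (expmx (H + lnmx A2)) <=
  rtr (expmx (H + lnmx (mix t A1 A2))).
Proof.
move=> hH pA1 pA2 t01.
pose G X A := rtr (H *m X) + entropy_dsum X A + rtr X.
have hL A : H + lnmx A \is hermsymmx by apply: herm_add hH (lnmx_herm A).
have GE A : rtr (expmx (H + lnmx A)) = G (expmx (H + lnmx A)) A.
  rewrite /G (entropy_dsum_rtr _ (expmx_posdef _)) (lnmx_expmx (hL A)).
  by rewrite mulmxDr rtrD (rtr_mulC H); ring.
have G_le X A : posdefmx X -> G X A <= rtr (expmx (H + lnmx A)).
  move=> pX; have := gibbs_le pX (hL A).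
  rewrite mulmxDr rtrD /G (entropy_dsum_rtr _ pX) (rtr_mulC H).
  by apply: le_trans; rewrite le_eqVlt; apply/orP; left; apply/eqP; ring.
(* A partial maximum of a jointly concave function is concave: maximisers at [A1] and [A2] mix to a
   competitor at the mixture. *)
suff concave_sup (F : 'M[C]_n -> R) :
    (forall A, exists2 X, posdefmx X & F A = G X A) ->
    (forall X A, posdefmx X -> G X A <= F A) ->
    t * F A1 + (1 - t) * F A2 <= F (mix t A1 A2).
  apply: (concave_sup (fun A => rtr (expmx (H + lnmx A)))) => [A|//].
  by exists (expmx (H + lnmx A)); [exact: expmx_posdef | exact: GE].
move=> FE F_le.
have [X1 pX1 ->] := FE A1; have [X2 pX2 ->] := FE A2.
apply: le_trans (F_le (mix t X1 X2) _ (posdefmx_convex pX1 pX2 t01)).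
have := entropy_dsum_concave pX1 pX2 pA1 pA2 t01.
by rewrite /G rtr_mulmx_mix rtr_mix; lra.
Qed.

End Lieb.

(** * The k-trace *)

Section KTrace.
Variables (R : realType) (n : nat).
Local Notation C := R[i].
Implicit Types (A L Z H U V : 'M[C]_n) (x y : 'rV[R]_n) (k : nat) (t : R).

Lemma char_poly_specmx U x : U \is unitarymx ->
  char_poly (specmx U x) = \prod_(i < n) ('X - (x 0 i)%:C%:P).
Proof.
move=> Uu; have UU : U ^t* *m U = 1%:M := mulmx1C (unitarymxP Uu).
pose D : 'M[C]_n := diag_mx (map_mx (real_complex R) x).
transitivity (char_poly D); last first.
  rewrite char_poly_trig ?diag_mx_is_trig //.
  by apply: eq_bigr => i _; rewrite !mxE eqxx mulr1n.
have PP : map_mx polyC (U ^t*) *m map_mx polyC U = 1%:M.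
  by rewrite -map_mxM UU map_mx1.
rewrite /char_poly.
have -> : char_poly_mx (specmx U x) =
    map_mx polyC (U ^t*) *m char_poly_mx D *m map_mx polyC U.
  rewrite /char_poly_mx mulmxBr mulmxBl /specmx !map_mxM.
  by rewrite scalar_mxC -[_%:M *m _ *m _]mulmxA PP mulmx1.
by rewrite !det_mulmx mulrAC -det_mulmx PP det1 mul1r.
Qed.

(** [eigenvalues] has an unspecified order; comparing factorisations of the characteristic
    polynomial gives a permutation, which [esym] ignores. *)
Lemma ktrace_specmx U x k : U \is unitarymx ->
  complex.Re (ktrace k (specmx U x)) = esym [set: 'I_n] k (fun i => x 0 i).
Proof.
move=> Uu; set ev := eigenvalues (specmx U x).
pose xs := [tuple (x 0 i)%:C | i < n].
have [s evE] : exists s : 'S_n, ev = [tuple tnth xs (s i) | i < n].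
  apply/tuple_permP; apply: prod_XsubC_eq.
  have := char_poly_specmx x Uu.
  rewrite /ev /eigenvalues; case: closed_field_poly_normal => r /= rE.
  rewrite {1}rE (monicP (char_poly_monic _)) scale1r => ->.
  by rewrite big_map big_enum.
have nthE (i : 'I_n) : ev`_i = (x 0 (s i))%:C.
  by rewrite evE -tnth_nth !tnth_mktuple.
rewrite -(esym_perm s) /ktrace complex_Re_sum; apply: eq_big => [J|J _].
  by rewrite finset.subsetT.
rewrite (eq_bigr (fun i => (x 0 (s i))%:C)) => [|i _]; last exact: nthE.
by rewrite -(rmorph_prod (real_complex R)).
Qed.

Lemma ktrace_expmx L k :
  complex.Re (ktrace k (expmx L)) = esym [set: 'I_n] k (fun i => expR (eigval L 0 i)).
Proof.
rewrite /expmx spectral_fun_eigval (ktrace_specmx _ _ (spectral_unitarymx L)).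
by congr esym; apply/funext => i; rewrite mxE.
Qed.

Lemma specmx_herm U x : U \is unitarymx -> specmx U x \is hermsymmx.
Proof.
move=> Uu; have -> : specmx U x = spectral_fun id (specmx U x).
  rewrite (spectral_fun_specmx _ _ Uu); congr specmx.
  by apply/matrixP => i j; rewrite !mxE.
exact: spectral_fun_herm.
Qed.

Lemma specmxD U x y : specmx U x + specmx U y = specmx U (x + y).
Proof. by rewrite /specmx map_mxD raddfD /= mulmxDr mulmxDl. Qed.

Lemma rtr_specmx_mul_same U x y : U \is unitarymx ->
  rtr (specmx U x *m specmx U y) = \sum_i x 0 i * y 0 i.
Proof.
move=> /unitarymxP UU; rewrite rtr_specmx_mul; apply: eq_bigr => i _.
rewrite (bigD1 i) //= big1 ?addr0 => [|j ji]; last first.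
  by rewrite /overlap UU mxE eq_sym (negbTE ji) mulr0 /= !mulr0.
by rewrite /overlap UU mxE eqxx mulr1n rmorph1 mulr1 /= mulr1.
Qed.

(* Test Gibbs' principle on matrices that are diagonal in the eigenbasis of [L]. *)
Lemma peierls L V x : L \is hermsymmx -> V \is unitarymx ->
  \sum_i expR (eigval L 0 i + \sum_j overlap (spectralmx L) V i j * x 0 j) <=
  rtr (expmx (L + specmx V x)).
Proof.
move=> hL Vu; set U := spectralmx L; set l := eigval L.
have Uu : U \is unitarymx := spectral_unitarymx L.
(* The diagonal of [L + specmx V x] in the eigenbasis of [L]. With test eigenvalues [expR (m i)] the
   energy and entropy terms cancel, leaving the trace of the test matrix. *)
pose m i := l 0 i + \sum_j overlap U V i j * x 0 j.
pose w : 'rV[R]_n := \row_i expR (m i).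
have wE i : w 0 i = expR (m i) by rewrite mxE.
have pX : posdefmx (specmx U w).
  by apply: (specmx_posdef Uu) => i; rewrite wE expR_gt0.
apply: le_trans (gibbs_le pX (herm_add hL (specmx_herm x Vu))).
rewrite mulmxDr rtrD rtr_specmx_mul (rtr_specmx _ Uu).
have -> : rtr (specmx U w *m L) = \sum_i w 0 i * l 0 i.
  by rewrite -(rtr_specmx_mul_same _ _ Uu) -(hermE hL).
have -> : rtr (specmx U w *m lnmx (specmx U w)) = \sum_i w 0 i * m i.
  rewrite /lnmx (spectral_fun_specmx _ _ Uu) (rtr_specmx_mul_same _ _ Uu).
  by apply: eq_bigr => i _; rewrite [in RHS]wE [map_mx _ _ _ _]mxE wE expRK.
rewrite -big_split -sumrB -big_split /=; apply: ler_sum => i _.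
rewrite wE -/(m i) le_eqVlt; apply/orP; left; apply/eqP.
have -> : \sum_j expR (m i) * x 0 j * overlap U V i j =
  expR (m i) * \sum_j overlap U V i j * x 0 j.
  by rewrite mulr_sumr; apply: eq_bigr => j _; rewrite -mulrA [x 0 j * _]mulrC.
by rewrite -mulrDr subrr add0r.
Qed.

Lemma root_exp (k : nat) (v : R) : (0 < k)%N -> 0 <= v ->
  powR (v ^+ k) k%:R^-1 = v.
Proof.
by move=> k0 v0; rewrite -powR_mulrn // -powRrM divff ?powRr1 // pnatr_eq0 -lt0n.
Qed.

Lemma root_le (k : nat) (u v : R) : (0 < k)%N -> 0 <= u -> 0 <= v ->
  u <= v ^+ k -> powR u k%:R^-1 <= v.
Proof.
move=> k0 u0 v0 uv.
rewrite -[leRHS](root_exp k0 v0).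
by rewrite ge0_ler_powR // ?nnegrE ?exprn_ge0 ?invr_ge0.
Qed.

Lemma rtr_expmx_ge0 L : 0 <= rtr (expmx L).
Proof.
rewrite /expmx spectral_fun_eigval (rtr_specmx _ (spectral_unitarymx L)).
by apply: sumr_ge0 => i _; rewrite mxE expR_ge0.
Qed.

(* [Z] is the logarithm of the gradient of [esym k ^ (1/k)] at the spectrum of
   [exp (H + ln A0)], in the eigenbasis of that matrix. *)
Lemma ktrace_root_support k H A0 : H \is hermsymmx -> (1 <= k <= n)%N ->
  exists Z, [/\ Z \is hermsymmx,
    forall A, powR (ktrace_exp_add_ln k H A) k%:R^-1 <= rtr (expmx (H + Z + lnmx A)) &
    powR (ktrace_exp_add_ln k H A0) k%:R^-1 = rtr (expmx (H + Z + lnmx A0))].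
Proof.
move=> hH kn; have /andP[k0 kn'] := kn.
have hL A : H + lnmx A \is hermsymmx by apply: herm_add hH (lnmx_herm A).
pose L0 := H + lnmx A0; pose V := spectralmx L0.
have Vu : V \is unitarymx := spectral_unitarymx L0.
have [y [y0 y_le yE]] := esym_supporting_linear kn (fun i => expR_gt0 (eigval L0 0 i)).
pose z : 'rV[R]_n := \row_i ln (y i).
exists (specmx V z); split=> [|A|]; first exact: specmx_herm Vu.
- rewrite addrAC; apply: root_le => //; first last.
  + rewrite /ktrace_exp_add_ln ktrace_expmx.
    have Uu := spectral_unitarymx (H + lnmx A).
    apply: le_trans (esym_le_linear_expR (eigval (H + lnmx A) 0) kn' y0 y_le
      (overlap_ge0 (spectralmx (H + lnmx A)) V)
      (fun i => overlap_row i Uu Vu) (fun j => overlap_col j Uu Vu)) _.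
    rewrite lerXn2r ?nnegrE ?rtr_expmx_ge0 //.
      by apply: sumr_ge0 => i _; exact: expR_ge0.
    apply: le_trans (peierls z (hL A) Vu).
    apply: ler_sum => i _; rewrite ler_expR lerD2l; apply: ler_sum => j _.
    by rewrite mxE.
  + exact: rtr_expmx_ge0.
  + by rewrite /ktrace_exp_add_ln ktrace_expmx esym_ge0 // => i; exact: expR_gt0.
- rewrite addrAC /ktrace_exp_add_ln ktrace_expmx -/L0 yE root_exp //; last first.
    by apply: sumr_ge0 => i _; rewrite mulr_ge0 ?expR_ge0 // ltW.
  (* [L0] and [Z] share the eigenbasis [V], so the exponential has eigenvalues
     [expR (eigval L0 0 i) * y i], the summands in [yE]. *)
  have -> : L0 + specmx V z = specmx V (eigval L0 + z).
    by rewrite -specmxD -(hermE (hL A0)).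
  rewrite /expmx (spectral_fun_specmx _ _ Vu) (rtr_specmx _ Vu).
  apply: eq_bigr => i _; rewrite !mxE expRD lnK //; exact: y0.
Qed.

(** The majorant is chosen to be exact at the mixture; Lieb's theorem for [H + Z] makes it
    concave. *)
Lemma ktrace_root_concave k H A B t : H \is hermsymmx -> (1 <= k <= n)%N ->
  posdefmx A -> posdefmx B -> 0 <= t <= 1 ->
  t * powR (ktrace_exp_add_ln k H A) k%:R^-1 +
    (1 - t) * powR (ktrace_exp_add_ln k H B) k%:R^-1 <=
  powR (ktrace_exp_add_ln k H (mix t A B)) k%:R^-1.
Proof.
move=> hH kn pA pB t01.
have [Z [hZ Z_le ZE]] := ktrace_root_support (mix t A B) hH kn.
have Z_ge : rtr (expmx (H + Z + lnmx (mix t A B))) <=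
    powR (ktrace_exp_add_ln k H (mix t A B)) k%:R^-1 by rewrite -ZE.
apply: le_trans Z_ge; apply: le_trans (lieb_concave (herm_add hH hZ) pA pB t01).
have /andP[t0 t1] := t01; rewrite -subr_ge0 in t1.
exact: lerD (ler_wpM2l t0 (Z_le A)) (ler_wpM2l t1 (Z_le B)).
Qed.

End KTrace.

(** * From the root to the logarithm *)

Lemma ln_concave (R : realType) (t u v : R) : 0 <= t <= 1 -> 0 < u -> 0 < v ->
  t * ln u + (1 - t) * ln v <= ln (t * u + (1 - t) * v).
Proof.
move=> /andP[t0 t1] u0 v0; rewrite -subr_ge0 in t1.
set m := t * u + (1 - t) * v.
have m0 : 0 < m by apply: pos_combination => //; rewrite subrKC.
(* Tangent-line bounds at the barycentre [m], whose linear terms cancel on averaging. *)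
have := lerD (ler_wpM2l t0 (ln_sub_le m0 u0)) (ler_wpM2l t1 (ln_sub_le m0 v0)).
have -> : t * ((u - m) / m) + (1 - t) * ((v - m) / m) = 0.
  by rewrite !mulrA -mulrDl; apply/eqP; rewrite mulf_eq0 /m; apply/orP; left; apply/eqP; ring.
lra.
Qed.

Theorem theorem2p1 (R : realType) (n k : nat) (hn : (1 <= n)%N)
    (hk : (1 <= k <= n)%N) (H : 'M[R[i]]_n) (hH : H \is hermsymmx) :
  concave_on (@posdefmx R n)
    (fun A => powR (ktrace_exp_add_ln k H A) (k%:R^-1)) /\
  concave_on (@posdefmx R n)
    (fun A => ln (ktrace_exp_add_ln k H A)).
Proof.
have /andP[k0 kn] := hk.
have root A B t := @ktrace_root_concave R n k H A B t hH hk.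
split=> [|A B t pA pB t01]; first exact: root.
have pos A' := (ktrace_exp_add_ln_gt0 H A' kn).1.
have kR : 0 < k%:R^-1 :> R by rewrite invr_gt0 ltr0n.
have := root A B t pA pB t01; rewrite -/(mix t A B).
move: (pos A) (pos B) (pos (mix t A B)).
move: (ktrace_exp_add_ln k H A) (ktrace_exp_add_ln k H B)
  (ktrace_exp_add_ln k H (mix t A B)) => u v w u0 v0 w0 uvw.
(* [ln] is increasing and concave, so it preserves concavity of the root, and the logarithm of the
   root is [k%:R^-1] times that of the k-trace. *)
rewrite -(ler_pM2l kR) -(ln_powR w).
have -> : k%:R^-1 * (t * ln u + (1 - t) * ln v) =
    t * ln (powR u k%:R^-1) + (1 - t) * ln (powR v k%:R^-1).
  by rewrite !ln_powR; ring.
apply: le_trans (ln_concave t01 (powR_gt0 _ u0) (powR_gt0 _ v0)) _.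
rewrite ler_ln ?posrE ?powR_gt0 //.
move: t01 => /andP[t0 t1]; apply: pos_combination; rewrite ?powR_gt0 ?subr_ge0 //.
by rewrite subrKC.
Qed.
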